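(* For an arbitrary finite, weighted, bipartite graph $\Gamma$, $$Gr(\Gamma,0)=\ast_{P_0(\Gamma,0)}\{Gr(\Gamma_w,0):w\in V_1\},$$ i.e. the operator-valued probability space $Gr(\Gamma,0)$ over $P_0(\Gamma,0)$ is generated by its subalgebras $Gr(\Gamma_w,0)$, $w\in V_1$, and these subalgebras are freely independent with amalgamation over $P_0(\Gamma,0)$.
   Context: Graphs. A graph $\Gamma$ means a finite, weighted, bipartite graph: a finite vertex set $V=V_0\sqcup V_1$ (even and odd vertices), a finite set $E$ of oriented edges with start and finish maps $s,f:E\to V$ and a reversal involution $\xi\mapsto\tilde\xi$ of $E$ interchanging $s$ and $f$, such that $s(\xi)\in V_0\Leftrightarrow f(\xi)\in V_1$, and a weighting $\mu:V\to(0,\infty)$ with $\sum_{v\in V}\mu^2(v)=1$. Multiple edges are allowed. A path $\xi$ of length $n\ge 0$ is $(v^\xi_0\xrightarrow{\xi_1}v^\xi_1\cdots\xrightarrow{\xi_n}v^\xi_n)$ with $\xi_i\in E$ an edge from $v^\xi_{i-1}$ to $v^\xi_i$; $s(\xi)=v_0^\xi$, $f(\xi)=v_n^\xi$. $Gr(\Gamma,0)$ is the complex algebra with basis all $[\xi]$, $\xi$ a path in $\Gamma$ beginning and ending at even vertices, with product $[\xi]\bullet[\eta]=[\xi\circ\eta]$ (concatenation) if $f(\xi)=s(\eta)$ and $0$ otherwise. $P_0(\Gamma,0)$ is the subalgebra spanned by the orthogonal idempotents $e_v=[(v)]$, $v\in V_0$ (length zero paths), which add up to $1$. The $P_0(\Gamma,0)$-bimodule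 map $\phi:Gr(\Gamma,0)\to P_0(\Gamma,0)$ is the identity on $P_0(\Gamma,0)$ and for $\xi$ of length $n\ge1$ is $$\phi([\xi])=\sum_{S}\ \prod_{\{i,j\}\in S,\ i<j}\Big(\delta_{\xi_i,\widetilde{\xi_j}}\frac{\mu(v_i^\xi)}{\mu(v_j^\xi)}\Big)\,e_{f(\xi)},$$ the sum being over all non-crossing pairings $S$ of $\{1,\dots,n\}$. This makes $Gr(\Gamma,0)$ an operator-valued probability space over $P_0(\Gamma,0)$. For $w\in V_1$, $\Gamma_w$ is the subgraph of $\Gamma$ induced on $V_0\cup\{w\}$ (with $\mu$ restricted and renormalised), and $Gr(\Gamma_w,0)$ is identified with the subalgebra of $Gr(\Gamma,0)$ generated by $P_0(\Gamma,0)$ and all $[\xi]$ with $\xi$ of length $2$ and $v_1^\xi=w$. Subalgebras $A_i\supseteq B$ ($i\in I$) of a $B$-valued probability space $(A,\phi)$ are freely independent with amalgamation over $B$ if $\phi(a_1a_2\cdots a_k)=0$ whenever $k\ge 1$, $a_j\in A_{i_j}$, $\phi(a_j)=0$ for all $j$, and $i_1\ne i_2,\ i_2\ne i_3,\dots,i_{k-1}\ne i_k$. *)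

(* Defs.v *)
From HB Require Import structures.
From mathcomp Require Import all_boot all_order all_algebra.
From mathcomp Require Import finmap monalg complex.
From mathcomp Require Import boolp classical_sets reals.

Set Implicit Arguments.
Unset Strict Implicit.
Unset Printing Implicit Defensive.

Import Order.TTheory GRing.Theory Num.Theory.

Local Open Scope ring_scope.
Local Open Scope classical_set_scope.

(* [phi], the expectation onto [B], is given as an endomap of [A]. *)
Definition free_with_amalgamation (A : pzRingType) (B : set A) (phi : A -> A)
    (I : Type) (A_ : I -> set A) : Prop :=
  (forall i, B `<=` A_ i) /\
  forall (k : nat) (i : nat -> I) (a : nat -> A),
    (0 < k)%N ->
    (forall j, (j < k)%N -> A_ (i j) (a j)) ->
    (forall j, (j < k)%N -> phi (a j) = 0) ->
    (forall j, (j.+1 < k)%N -> i j <> i j.+1) ->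
    phi (\prod_(0 <= j < k) a j) = 0.

Record wgraph (R : realType) := WGraph {
  vert : finType;
  edge : finType;
  oddv : pred vert;
  src : edge -> vert;
  tgt : edge -> vert;
  rev : edge -> edge;
  revK : involutive rev;
  src_rev : forall e, src (rev e) = tgt e;
  tgt_rev : forall e, tgt (rev e) = src e;
  bipartite : forall e, ~~ oddv (src e) <-> oddv (tgt e);
  mu : vert -> R;
  mu_gt0 : forall v, 0 < mu v;
  mu_sum : \sum_v mu v ^+ 2 = 1
}.

Section Paths.
Variables (R : realType) (Gam : wgraph R).

Definition even_vert := {v : vert Gam | ~~ oddv v}.
Definition odd_vert := {v : vert Gam | oddv v}.

Fixpoint is_path (v : vert Gam) (s : seq (edge Gam)) : bool :=
  if s is e :: s' then (src e == v) && is_path (tgt e) s' else true.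

Definition finish (v : vert Gam) (s : seq (edge Gam)) : vert Gam :=
  last v [seq tgt e | e <- s].

Definition is_epath (p : vert Gam * seq (edge Gam)) : bool :=
  [&& ~~ oddv p.1, is_path p.1 p.2 & ~~ oddv (finish p.1 p.2)].

(* A path is stored as its initial vertex and its edges, so that there is one
   path of length zero at each vertex. *)
Record epath := EPath {
  epath_val : vert Gam * seq (edge Gam);
  epathP : is_epath epath_val
}.

HB.instance Definition _ := [isSub for epath_val].
HB.instance Definition _ := [Choice of epath by <:].

Definition pstart (p : epath) : vert Gam := (epath_val p).1.
Definition pedges (p : epath) : seq (edge Gam) := (epath_val p).2.
Definition pfinish (p : epath) : vert Gam := finish (pstart p) (pedges p).
Definition plength (p : epath) : nat := size (pedges p).

Definition pvert (p : epath) (i : nat) : vert Gam :=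
  nth (pstart p) (pstart p :: [seq tgt e | e <- pedges p]) i.

(* Edges are numbered from 0: [pedge p i] goes from [pvert p i] to
   [pvert p i.+1]. *)
Definition pedge (p : epath) (i : 'I_(plength p)) : edge Gam :=
  tnth (in_tuple (pedges p)) i.

Lemma finish_cat v s t : finish v (s ++ t) = finish (finish v s) t.
Proof. by rewrite /finish map_cat last_cat. Qed.

Lemma is_path_cat v s t :
  is_path v (s ++ t) = is_path v s && is_path (finish v s) t.
Proof. by elim: s v => //= e s IH v; rewrite IH andbA. Qed.

Lemma pnil_subproof (v : even_vert) : is_epath (val v, [::]).
Proof. by rewrite /is_epath /finish /= (valP v). Qed.

Definition pnil (v : even_vert) : epath := EPath (pnil_subproof v).

Lemma pfinish_subproof p : ~~ oddv (pfinish p).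
Proof. by case: p => -[v s] H; case/and3P: (H). Qed.

Definition efinish (p : epath) : even_vert :=
  exist _ (pfinish p) (pfinish_subproof p).

Lemma pcomp_subproof p q : pfinish p = pstart q ->
  is_epath (pstart p, pedges p ++ pedges q).
Proof.
case: p q => -[v s] Hp [-[w t] Hq]; rewrite /pfinish /pstart /pedges /= => E.
move: Hp Hq; rewrite /is_epath /= => /and3P[-> Hs _] /and3P[_ Ht Hf].
by rewrite is_path_cat finish_cat Hs E Ht Hf.
Qed.

Definition pcomp p q (pq : pfinish p = pstart q) : epath :=
  EPath (pcomp_subproof pq).

End Paths.

HB.lock Definition linext (K : choiceType) (F : nzRingType) (V : lmodType F)
    (f : K -> V) (x : {malg F[K]}) : V :=
  \sum_(k <- msupp x) x@_k *: f k.

Section LinearExtension.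
Variables (K : choiceType) (F : nzRingType) (V : lmodType F).
Implicit Types (f : K -> V) (x y : {malg F[K]}).

Lemma linextw f x (d : {fset K}) : (msupp x `<=` d)%fset ->
  linext f x = \sum_(k <- d) x@_k *: f k.
Proof.
move=> xd; rewrite linext.unlock; apply: big_fset_incl => // k _ kx.
by rewrite (mcoeff_outdom kx) scale0r.
Qed.

Lemma linext_is_linear f : linear (linext f).
Proof.
move=> a x y; set d := (msupp x `|` msupp y)%fset.
have dz : (msupp (a *: x + y)%R `<=` d)%fset.
  apply/fsubsetP => k; rewrite in_fsetU; apply: contraLR.
  rewrite negb_or => /andP[/mcoeff_outdom xk /mcoeff_outdom yk].
  by rewrite -mcoeff_eq0 mcoeffD mcoeffZ xk yk mulr0 addr0.
rewrite (linextw f dz) (@linextw f x d) ?fsubsetUl //.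
rewrite (@linextw f y d) ?fsubsetUr //.
rewrite scaler_sumr -big_split /=; apply: eq_bigr => k _.
by rewrite mcoeffD mcoeffZ scalerDl scalerA.
Qed.

HB.instance Definition _ f :=
  GRing.isLinear.Build F {malg F[K]} V _ (linext f) (linext_is_linear f).

Lemma linextU f k : linext f << k >> = f k.
Proof.
by rewrite linext.unlock msuppU oner_eq0 big_seq_fset1 mcoeffUU scale1r.
Qed.

Lemma malg_basisE x : x = \sum_(k <- msupp x) x@_k *: << k >>.
Proof.
rewrite {1}[x]monalgE; apply: eq_bigr => k _; apply/malgP => l.
by rewrite mcoeffZ !mcoeffU mulrnAr mulr1.
Qed.

Lemma eq_on_basis (f g : {linear {malg F[K]} -> V}) :
  (forall k, f << k >> = g << k >>) -> f =1 g.
Proof.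
move=> fg x; rewrite [x]malg_basisE !linear_sum; apply: eq_bigr => k _.
by rewrite !linearZ /= fg.
Qed.

End LinearExtension.

Definition Gr (R : realType) (Gam : wgraph R) := {malg R[i][epath Gam]}.

HB.instance Definition _ (R : realType) (Gam : wgraph R) :=
  GRing.Lmodule.on (Gr Gam).

(* Locked, like [linext], to keep conversion from unfolding finite maps. *)
HB.lock Definition path_elt (R : realType) (Gam : wgraph R) (p : epath Gam) :
  Gr Gam := << p >>.

Section GraphAlgebra.
Variables (R : realType) (Gam : wgraph R).
Implicit Types p q r : epath Gam.

Local Notation Gr := (Gr Gam).

Definition idem (v : even_vert Gam) : Gr := path_elt (pnil v).

Definition path_mul (p q : epath Gam) : Gr :=
  if pfinish p =P pstart q is ReflectT pq then path_elt (pcomp pq) else 0.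

Definition Gr_mul (x y : Gr) : Gr :=
  linext (fun p => linext (path_mul p) y) x.

Definition Gr_one : Gr := \sum_v idem v.

Lemma Gr_mulE p q : Gr_mul (path_elt p) (path_elt q) = path_mul p q.
Proof. by rewrite /Gr_mul path_elt.unlock !linextU. Qed.

Definition Gr_mulr (y x : Gr) : Gr := Gr_mul x y.

Lemma Gr_mul_linl y : linear (Gr_mulr y).
Proof. exact: linext_is_linear. Qed.

Lemma Gr_mul_linr x : linear (Gr_mul x).
Proof.
move=> a y z.
have E t : Gr_mul x t =
    \sum_(p <- msupp x) x@_p *: linext (path_mul p) (t : {malg R[i][epath Gam]}).
  by rewrite /Gr_mul {1}linext.unlock.
rewrite !E scaler_sumr -big_split /=; apply: eq_bigr => k _.
by rewrite linext_is_linear scalerDr !scalerA mulrC.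
Qed.

HB.instance Definition _ y :=
  GRing.isLinear.Build R[i] Gr Gr _ (Gr_mulr y) (Gr_mul_linl y).
HB.instance Definition _ x :=
  GRing.isLinear.Build R[i] Gr Gr _ (Gr_mul x) (Gr_mul_linr x).

Lemma path_mulE p q (pq : pfinish p = pstart q) :
  path_mul p q = path_elt (pcomp pq).
Proof.
by rewrite /path_mul; case: eqP => // pq'; rewrite (eq_irrelevance pq' pq).
Qed.

Lemma path_mul0 p q : pfinish p != pstart q -> path_mul p q = 0.
Proof. by rewrite /path_mul; case: eqP. Qed.

Lemma pcomp_start p q (pq : pfinish p = pstart q) :
  pstart (pcomp pq) = pstart p.
Proof. by []. Qed.

Lemma pcomp_finish p q (pq : pfinish p = pstart q) :
  pfinish (pcomp pq) = pfinish q.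
Proof. by rewrite /pfinish finish_cat -/(pfinish p) pq. Qed.

Lemma Gr_eq_on_basis (f g : {linear Gr -> Gr}) :
  (forall p, f (path_elt p) = g (path_elt p)) -> f =1 g.
Proof. by rewrite path_elt.unlock; exact: eq_on_basis. Qed.

Lemma Gr_mulA : associative Gr_mul.
Proof.
have E3 p q r : Gr_mul (path_elt p) (Gr_mul (path_elt q) (path_elt r)) =
                Gr_mul (Gr_mul (path_elt p) (path_elt q)) (path_elt r).
  rewrite !Gr_mulE.
  have [pq|pq] := eqVneq (pfinish p) (pstart q); last first.
    rewrite (path_mul0 pq) [RHS]linear0.
    have [qr|qr] := eqVneq (pfinish q) (pstart r); last first.
      by rewrite (path_mul0 qr) linear0.
    by rewrite (path_mulE qr) Gr_mulE path_mul0.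
  rewrite (path_mulE pq) Gr_mulE.
  have [qr|qr] := eqVneq (pfinish q) (pstart r); last first.
    by rewrite (path_mul0 qr) linear0 path_mul0 // pcomp_finish.
  have pqr : pfinish (pcomp pq) = pstart r by rewrite pcomp_finish.
  have pqr' : pfinish p = pstart (pcomp qr) by rewrite pcomp_start.
  rewrite (path_mulE qr) Gr_mulE (path_mulE pqr) (path_mulE pqr').
  by congr path_elt; apply: val_inj; rewrite /= /pedges /= catA.
have E2 p q : Gr_mul (path_elt p) \o Gr_mul (path_elt q)
                =1 Gr_mul (Gr_mul (path_elt p) (path_elt q)).
  exact: (@Gr_eq_on_basis (Gr_mul (path_elt p) \o Gr_mul (path_elt q))
            (Gr_mul (Gr_mul (path_elt p) (path_elt q))) (E3 p q)).
have E1 p z : Gr_mul (path_elt p) \o Gr_mulr z =1 Gr_mulr z \o Gr_mul (path_elt p).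
  by apply: (@Gr_eq_on_basis (Gr_mul (path_elt p) \o Gr_mulr z)
               (Gr_mulr z \o Gr_mul (path_elt p))) => q; exact: E2.
move=> x y z.
by apply: (@Gr_eq_on_basis (Gr_mulr (Gr_mul y z))
   (Gr_mulr z \o Gr_mulr y)) => p; exact: E1.
Qed.

Lemma Gr_mul1l : left_id Gr_one Gr_mul.
Proof.
apply: (@Gr_eq_on_basis (Gr_mul Gr_one) idfun) => q.
rewrite [LHS](linear_sum (Gr_mulr (path_elt q))) /=.
have evq : ~~ oddv (pstart q) by case/and3P: (epathP q).
rewrite (bigD1 (exist _ (pstart q) evq)) //= [X in _ + X]big1 => [|v vq].
  rewrite addr0 /Gr_mulr Gr_mulE path_mulE; congr path_elt; apply: val_inj => /=.
  by rewrite [RHS]surjective_pairing.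
by rewrite /Gr_mulr Gr_mulE path_mul0 //; apply: contra vq => /eqP vq; apply/eqP/val_inj.
Qed.

Lemma Gr_mul1r : right_id Gr_one Gr_mul.
Proof.
apply: (@Gr_eq_on_basis (Gr_mulr Gr_one) idfun) => q.
rewrite [LHS](linear_sum (Gr_mul (path_elt q))) /=.
rewrite (bigD1 (efinish q)) //= [X in _ + X]big1 => [|v vq].
  rewrite addr0 /Gr_mulr Gr_mulE path_mulE; congr path_elt; apply: val_inj => /=.
  by rewrite cats0 [RHS]surjective_pairing.
rewrite Gr_mulE path_mul0 //; apply: contra vq => /eqP vq.
by apply/eqP/val_inj; rewrite /= vq.
Qed.

Lemma Gr_mulDl : left_distributive Gr_mul +%R.
Proof. by move=> x y z; exact: (linearD (Gr_mulr z)). Qed.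

Lemma Gr_mulDr : right_distributive Gr_mul +%R.
Proof. by move=> x y z; exact: (linearD (Gr_mul x)). Qed.

(* 1 = 0 is possible here: [Gam] may have no even vertex. *)
HB.instance Definition _ := GRing.Zmodule_isPzRing.Build Gr
  Gr_mulA Gr_mul1l Gr_mul1r Gr_mulDl Gr_mulDr.

Lemma Gr_scalerAl (c : R[i]) (x y : Gr) : c *: (x * y) = (c *: x) * y.
Proof. by rewrite [RHS](linearZ_LR (Gr_mulr y)). Qed.

Lemma Gr_scalerAr (c : R[i]) (x y : Gr) : c *: (x * y) = x * (c *: y).
Proof. by rewrite [RHS](linearZ_LR (Gr_mul x)). Qed.

Definition subalgebra (S : set Gr) : Prop :=
  GRing.submod_closed [in S] /\ GRing.mulr_closed [in S].

Definition gen_subalgebra (G : set Gr) : set Gr := smallest subalgebra G.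

Lemma gen_subalgebraP (G : set Gr) : subalgebra (gen_subalgebra G).
Proof.
split; split.
- by apply/mem_set => S /= [[[/set_mem]]].
- move=> c x y /set_mem xS /set_mem yS.
  apply/mem_set => S /= SG; have [[[_ SL] _] _] := SG.
  by apply/set_mem/SL; apply/mem_set; [exact: xS | exact: yS].
- by apply/mem_set => S /= [[_ [/set_mem]]].
- move=> x y /set_mem xS /set_mem yS.
  apply/mem_set => S /= SG; have [[_ [_ SM]] _] := SG.
  by apply/set_mem/SM; apply/mem_set; [exact: xS | exact: yS].
Qed.

Definition P0 : set Gr :=
  [set x | exists c : even_vert Gam -> R[i], x = \sum_v c v *: idem v].

Definition nc_pairing (n : nat) (S : {set {set 'I_n}}) : bool :=
  [&& finset.partition S [set: 'I_n]%SET,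
      [forall B in S, #|B| == 2%N] &
      [forall i : 'I_n, forall j : 'I_n, forall k : 'I_n, forall l : 'I_n,
        [&& (i < j)%N, (j < k)%N & (k < l)%N] ==>
        ~~ (([set i; k]%SET \in S) && ([set j; l]%SET \in S))]].

Definition pairing_weight (p : epath Gam) (S : {set {set 'I_(plength p)}}) : R :=
  \prod_(i < plength p)
    \prod_(j < plength p | (i < j)%N && ([set i; j]%SET \in S))
      ((pedge i == rev (pedge j))%:R *
         (mu (pvert p i.+1) / mu (pvert p j.+1))).

Definition phi_coef (p : epath Gam) : R :=
  \sum_(S : {set {set 'I_(plength p)}} | nc_pairing S) pairing_weight S.

(* For a path of length zero the only pairing is the empty one, of weight 1:
   see [phi_idem]. *)
Definition phi_path (p : epath Gam) : Gr :=
  (phi_coef p)%:C%C *: idem (efinish p).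

Definition phi : Gr -> Gr := linext phi_path.

HB.instance Definition _ := GRing.Linear.on phi.

Lemma phi_path_elt p : phi (path_elt p) = phi_path p.
Proof. by rewrite path_elt.unlock [LHS]linextU. Qed.

(* The copy inside [Gr] of the algebra of the subgraph induced on the even
   vertices and [w]. *)
Definition Grw (w : odd_vert Gam) : set Gr :=
  gen_subalgebra
    (P0 `|` [set path_elt p | p in [set p | plength p = 2%N /\ pvert p 1 = val w]]).

Let mulGrE (x y : Gr) : Gr_mul x y = x * y.
Proof. by []. Qed.

Lemma mul_path p q (pq : pfinish p = pstart q) :
  path_elt p * path_elt q = path_elt (pcomp pq).
Proof. by rewrite -path_mulE; exact: Gr_mulE. Qed.

Lemma mul_path0 p q : pfinish p != pstart q ->
  path_elt p * path_elt q = 0.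
Proof. by move=> /path_mul0 <-; exact: Gr_mulE. Qed.

Lemma idem_mul_path v p :
  idem v * path_elt p = (val v == pstart p)%:R *: path_elt p.
Proof.
have [vp|vp] := eqVneq (val v) (pstart p); last first.
  by rewrite scale0r mul_path0.
rewrite scale1r mul_path; congr path_elt; apply: val_inj => /=.
by rewrite [RHS]surjective_pairing -/(pstart p) -vp.
Qed.

Lemma path_mul_idem p v :
  path_elt p * idem v = (pfinish p == val v)%:R *: path_elt p.
Proof.
have [vp|vp] := eqVneq (pfinish p) (val v); last first.
  by rewrite scale0r mul_path0.
rewrite scale1r mul_path; congr path_elt; apply: val_inj => /=.
by rewrite cats0 [RHS]surjective_pairing.
Qed.

Lemma idem_mul u v : idem u * idem v = (u == v)%:R *: idem v.
Proof. by rewrite idem_mul_path. Qed.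

Lemma P0_idem v : P0 (idem v).
Proof.
exists (fun u => (u == v)%:R); rewrite (bigD1 v) //= eqxx scale1r.
by rewrite big1 ?addr0 // => u /negbTE ->; rewrite scale0r.
Qed.

Lemma P0_subalgebra : subalgebra P0.
Proof.
split; split.
- apply/mem_set; exists (fun=> 0).
  by rewrite big1 // => v _; rewrite scale0r.
- move=> a x y /set_mem[c ->] /set_mem[d ->]; apply/mem_set.
  exists (fun v => a * c v + d v); rewrite scaler_sumr -big_split /=.
  by apply: eq_bigr => v _; rewrite scalerDl scalerA.
- apply/mem_set; exists (fun=> 1).
  by apply: eq_bigr => v _; rewrite scale1r.
- move=> x y /set_mem[c ->] /set_mem[d ->]; apply/mem_set.
  exists (fun v => c v * d v); rewrite mulr_suml; apply: eq_bigr => v _.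
  rewrite mulr_sumr (bigD1 v) //= big1 => [|u uv].
    by rewrite addr0 -Gr_scalerAl -Gr_scalerAr idem_mul eqxx scale1r scalerA.
  rewrite -Gr_scalerAl -Gr_scalerAr idem_mul eq_sym (negbTE uv).
  by rewrite scale0r !scaler0.
Qed.

Lemma P0_phi x : P0 (phi x).
Proof.
have [[_ PL] _] := P0_subalgebra.
have P00 : 0 \in P0 by case: P0_subalgebra => -[].
rewrite /phi linext.unlock; apply: set_mem.
elim/big_rec: _ => // p y _ yP; apply: (PL) => //.
rewrite /phi_path -[_ *: _]addr0; apply: (PL) => //.
by apply/mem_set/P0_idem.
Qed.

Lemma phi_coef_pnil v : phi_coef (pnil v) = 1.
Proof.
have E (S : {set {set 'I_0}}) : nc_pairing S = (S == finset.set0).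
  apply/idP/eqP => [/and3P[/and3P[_ _ S0] _ _]|->].
    apply/setP => B; rewrite inE; apply/negbTE; apply: contra S0.
    suff -> : B = finset.set0 by [].
    by apply/setP => -[].
  rewrite /nc_pairing /finset.partition /finset.trivIset /finset.cover !big_set0 cards0 inE.
  rewrite eqxx !andbT; apply/and3P; split; first by apply/eqP/setP => -[].
    by apply/forall_inP => B; rewrite inE.
  by apply/forallP => -[].
rewrite /phi_coef (eq_bigl (fun S => S == finset.set0)) => [|S]; last exact: E.
by rewrite big_pred1_eq /pairing_weight big_ord0.
Qed.

Lemma phi_idem v : phi (idem v) = idem v.
Proof.
rewrite /idem phi_path_elt /phi_path phi_coef_pnil rmorph1 scale1r.
by congr idem; apply: val_inj.
Qed.

Lemma phi_id x : P0 x -> phi x = x.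
Proof.
move=> [c ->]; rewrite linear_sum; apply: eq_bigr => v _.
by rewrite linearZ /= phi_idem.
Qed.

Lemma sum_boundary u v s : is_path v s ->
  \sum_(e <- s) ((tgt e == u :> vert Gam)%:R - (src e == u)%:R : int) =
    (finish v s == u)%:R - (v == u)%:R.
Proof.
elim: s v => [|e s IH] v /=; first by rewrite big_nil subrr.
case/andP=> /eqP <- es; rewrite big_cons (IH _ es).
by rewrite addrC addrA subrK.
Qed.

Lemma phi_coef_neq0 p : phi_coef p != 0 -> pstart p = pfinish p.
Proof.
move=> c0.
have [S ncS wS] : exists2 S, nc_pairing S & @pairing_weight p S != 0.
  apply/exists_inP; apply: contraNT c0 => /exists_inPn w0.
  by apply/eqP/big1 => S /w0 /negPn /eqP.
have /and3P[partS /forall_inP S2 _] := ncS.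
have /and3P[/eqP covS trivS _] := partS.
pose F (e : edge Gam) : int :=
  (tgt e == pfinish p)%:R - (src e == pfinish p)%:R.
have Frev e : F e + F (rev e) = 0.
  by rewrite /F src_rev tgt_rev addrC addrA subrK subrr.
have match_ (i j : 'I_(plength p)) : (i < j)%N -> [set i; j]%SET \in S ->
    pedge i = rev (pedge j).
  move=> ij ijS; move: wS => /prodf_neq0 /(_ i isT) /prodf_neq0 /(_ j).
  rewrite ij ijS => /(_ isT); rewrite mulf_eq0 negb_or => /andP[+ _].
  by rewrite pnatr_eq0 eqb0 negbK => /eqP.
have F0 : \sum_(i < plength p) F (pedge i) = 0.
  transitivity (\sum_(i in finset.cover S) F (pedge i)).
    by apply: eq_bigl => i; rewrite covS inE.
  rewrite (big_trivIset _ trivS); apply: big1 => B BS.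
  have /cards2P[i [j [ij EB]]] := S2 B BS.
  rewrite EB in BS *; rewrite big_setU1 ?inE //= big_set1.
  have [lt|gt|/val_inj e] := ltngtP i j; last by rewrite e eqxx in ij.
    by rewrite (match_ i j) // addrC Frev.
  by rewrite (match_ j i) ?Frev // finset.setUC.
have /and3P[_ pathp _] := epathP p.
have : 0 = (pfinish p == pfinish p)%:R - (pstart p == pfinish p)%:R :> int.
  by rewrite -(sum_boundary (pfinish p) pathp) (big_tnth _ _ (pedges p)); rewrite -[LHS]F0.
have [//|_] := eqVneq (pstart p) (pfinish p).
by rewrite eqxx.
Qed.

Lemma phi_idem_mul v a : phi (idem v * a) = idem v * phi a.
Proof.
apply: (@Gr_eq_on_basis (phi \o Gr_mul (idem v)) (Gr_mul (idem v) \o phi)) => p.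
rewrite /= !mulGrE idem_mul_path linearZ /= phi_path_elt.
rewrite /phi_path -Gr_scalerAr idem_mul !scalerA mulrC.
have [->|/phi_coef_neq0 sf] := eqVneq (phi_coef p) 0.
  by rewrite rmorph0 !mul0r.
by rewrite sf.
Qed.

Lemma phi_mul_idem a v : phi (a * idem v) = phi a * idem v.
Proof.
apply: (@Gr_eq_on_basis (phi \o Gr_mulr (idem v)) (Gr_mulr (idem v) \o phi)) => p.
rewrite /= /Gr_mulr !mulGrE path_mul_idem linearZ /= phi_path_elt.
rewrite /phi_path -Gr_scalerAl path_mul_idem /= !scalerA mulrC.
by rewrite /pfinish /finish /=.
Qed.

Lemma phi_bimodule b a b' : P0 b -> P0 b' -> phi (b * a * b') = b * phi a * b'.
Proof.
move=> [c ->] [d ->].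
have L x : phi ((\sum_v c v *: idem v) * x) = (\sum_v c v *: idem v) * phi x.
  rewrite !mulr_suml linear_sum; apply: eq_bigr => u _.
  by rewrite -!Gr_scalerAl linearZ /= phi_idem_mul.
rewrite -mulrA L -mulrA; congr (_ * _).
rewrite !mulr_sumr linear_sum; apply: eq_bigr => u _.
by rewrite -!Gr_scalerAr linearZ /= phi_mul_idem.
Qed.

Lemma Grw_subalgebra w : subalgebra (Grw w).
Proof. exact: gen_subalgebraP. Qed.

Lemma P0_sub_Grw w : P0 `<=` Grw w.
Proof. by apply: sub_smallest; exact: subsetUl. Qed.

End GraphAlgebra.

Arguments P0 {R} Gam _.

(* Main.v *)
Require Import Defs.
From HB Require Import structures.
From mathcomp Require Import all_boot all_order all_algebra.
From mathcomp Require Import monalg complex classical_sets reals.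

(** Reading a path edge by edge while maintaining a stack of edges, each new edge
    being either pushed or matched against the top, enumerates the non-crossing
    pairings. So every edge acts on functions of stacks (weighted creation plus
    annihilation), and [phi] is the vacuum coefficient of this representation.
    An element of [Grw w] that [phi] kills sends the vacuum to a combination of
    nonempty stacks of edges through [w]; on stacks whose top edge avoids [w] no
    annihilation reaches them, and it acts by putting the same combination on top.
    An alternating product of such elements thus sends the vacuum to nonempty
    stacks, so its expectation is zero. *)

Set Implicit Arguments.
Unset Strict Implicit.
Unset Printing Implicit Defensive.

Import GRing.Theory.

Local Open Scope ring_scope.

(** * Words acting on functions of stacks *)

Section WordAction.
Variables (K : comPzRingType) (E : eqType) (rv : E -> E) (kap : E -> K).
Implicit Types (e : E) (s t : seq E) (f g : seq E -> K).

(* Creation of [e] with weight [kap e], plus annihilation of [rv e]. Dually, this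
   collects the values of [f] at the stacks reached from [t] by reading [e]: a top
   equal to [e] is popped, or [rv e] is pushed. *)
Definition letter_act e f t : K :=
  (if t is e' :: t' then (e' == e)%:R * kap e * f t' else 0) + f (rv e :: t).

Definition word_act s f : seq E -> K := foldr letter_act f s.

Definition vac t : K := (t == [::])%:R.

Lemma word_act_linear s (c : K) f g t :
  word_act s (fun t => c * f t + g t) t = c * word_act s f t + word_act s g t.
Proof.
elim: s t => //= e s IH t; rewrite /letter_act !IH mulrDr addrACA; congr (_ + _).
case: t => [|e' t]; first by rewrite mulr0 addr0.
by rewrite IH mulrDr mulrCA.
Qed.

Lemma word_actZ s (c : K) f t :
  word_act s (fun t => c * f t) t = c * word_act s f t.
Proof.
elim: s t => //= e s IH t; rewrite /letter_act !IH mulrDr; congr (_ + _).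
by case: t => [|e' t]; rewrite ?mulr0 // IH mulrCA.
Qed.

Lemma word_act_ext s f g : f =1 g -> word_act s f =1 word_act s g.
Proof.
move=> fg; elim: s => //= e s IH [|e' t]; rewrite /letter_act !IH //.
Qed.

(** The reading must end at the empty stack, so each entry of [t] is popped by an equal letter of
    [s]. *)
Lemma word_act_color (col : pred E) s t :
  all col s -> (forall e, col e -> col (rv e)) ->
  word_act s vac t != 0 -> all col t.
Proof.
move=> + col_rv; elim: s t => [|e s IH] t /=.
  by rewrite /vac; case: t => [|e t] //=; rewrite eqxx.
case/andP=> ce cs; rewrite /letter_act.
have [->|/(IH _ cs)/= /andP[_ //]] := eqVneq (word_act s vac (rv e :: t)) 0.
rewrite addr0; case: t => [|e' t] //=.
have [->|_] := eqVneq e' e; last by rewrite !mul0r eqxx.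
rewrite ce /= => h; apply: IH => //.
by apply: contraNneq h => ->; rewrite mulr0.
Qed.

(* No annihilation in [s] reaches the support of [f], so [s] puts on top of it the
   stacks that it makes from the vacuum. *)
Lemma word_act_factor (col : pred E) s f t :
  all col s -> (forall e, col e -> col (rv e)) ->
  (forall e t', col e -> f (e :: t') = 0) ->
  word_act s f t =
    \sum_(i < (size t).+1) word_act s vac (take i t) * f (drop i t).
Proof.
move=> + col_rv f0; elim: s t => [|e s IH] t /=.
  move=> _; rewrite big_ord_recl take0 drop0 /vac eqxx mul1r big1 ?addr0 // => i _.
  by case: t i => [[]|e t i] //=; rewrite mul0r.
case/andP=> ce cs; rewrite /letter_act.
under [RHS]eq_bigr do rewrite mulrDl.
rewrite big_split /=; congr (_ + _).
  case: t => [|e' t]; first by rewrite big_ord1 mul0r.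
  rewrite IH // mulr_sumr [RHS]big_ord_recl /= mul0r add0r.
  by apply: eq_bigr => i _; rewrite !mulrA.
(* The extra term of [IH], where the upper part is empty, evaluates [f] at a stack with top [rv e],
   and [f0] kills it. *)
rewrite IH //= big_ord_recl /= f0 ?col_rv // mulr0 add0r.
by apply: eq_bigr => i _.
Qed.

End WordAction.

(** * Non-crossing pairings enumerated by reading with a stack *)

Section NoncrossingPairings.
Variables (K : comPzRingType) (E : eqType) (rv : E -> E) (kap : E -> K).
Hypothesis rvK : involutive rv.
Variable n : nat.
Implicit Types (S : {set {set 'I_n}}) (T : seq 'I_n) (A B : {set 'I_n}).

Definition noncrossing S : bool :=
  [forall i : 'I_n, forall j : 'I_n, forall k : 'I_n, forall l : 'I_n,
    [&& (i < j)%N, (j < k)%N & (k < l)%N] ==>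
    ~~ (([set i; k]%SET \in S) && ([set j; l]%SET \in S))].

Lemma noncrossingP S :
  reflect (forall i j k l : 'I_n, (i < j < k)%N -> (k < l)%N ->
             [set i; k]%SET \in S -> [set j; l]%SET \in S -> False)
          (noncrossing S).
Proof.
apply: (iffP forallP) => [H i j k l /andP[ij jk] kl ik jl|H i].
  move: (H i) => /forallP/(_ j)/forallP/(_ k)/forallP/(_ l).
  by rewrite ij jk kl ik jl.
apply/forallP => j; apply/forallP => k; apply/forallP => l.
apply/implyP => /and3P[ij jk kl]; apply/negP => /andP[ik jl].
by apply: (H i j k l) => //; rewrite ij jk.
Qed.

(* [T] lists, innermost first, the points below [m] that are still waiting for a
   partner at or above [m]. *)
Definition open_dom T (m : nat) : {set 'I_n} :=
  [set x | (x \in T) || (m <= x)%N]%SET.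

(** Two waiting points may not be matched together: the last clause sends the partner of each to a
    position at or above [m]. *)
Definition open_pairing T (m : nat) S : bool :=
  [&& finset.partition S (open_dom T m),
      [forall B in S, #|B| == 2%N],
      noncrossing S &
      [forall B in S, ~~ (B \subset T)]].

Variable w : 'I_n -> 'I_n -> K.

Definition pairing_prod S : K :=
  \prod_(i < n) \prod_(j < n | (i < j)%N && ([set i; j]%SET \in S)) w i j.

Lemma set2_ltn_inj (a b c d : 'I_n) :
  (a < b)%N -> (c < d)%N -> [set a; b]%SET = [set c; d]%SET -> a = c /\ b = d.
Proof.
move=> ab cd /setP e.
have := e a; have := e b; rewrite !inE !eqxx ?orbT /=.
move=> /esym/orP[]/eqP eb /esym/orP[]/eqP ea; subst => //.
- by rewrite ltnn in ab.
- by have := ltn_trans ab cd; rewrite ltnn.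
- by rewrite ltnn in ab.
Qed.

Lemma pairing_prodU1 S (a b : 'I_n) : (a < b)%N -> [set a; b]%SET \notin S ->
  pairing_prod ([set a; b]%SET |: S)%SET = w a b * pairing_prod S.
Proof.
move=> ab nS; rewrite /pairing_prod !pair_big_dep /= (bigD1 (a, b)) /=; last first.
  by rewrite ab !inE eqxx.
congr (_ * _); apply: eq_bigl => -[x y] /=.
have [xy|] := ltnP x y => //=; rewrite !inE.
have [/(set2_ltn_inj xy ab)[-> ->]|ne] := eqVneq [set x; y]%SET [set a; b]%SET.
  by rewrite eqxx /= (negbTE nS).
rewrite /=; case: eqP => [[ex ey]|]; last by rewrite andbT.
by rewrite ex ey eqxx in ne.
Qed.

(* In an [open_pairing T o S], either [o] waits for a later partner (push) or it is
   matched with the innermost waiting point, by non-crossingness (pop). *)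
Lemma open_pairing_push T (o : 'I_n) S :
  open_pairing T o S && ~~ [exists x in T, [set x; o]%SET \in S] =
  open_pairing (o :: T) o.+1 S.
Proof.
have dom : open_dom (o :: T) o.+1 = open_dom T o.
  apply/setP => x; rewrite !inE (leq_eqVlt o x) -val_eqE /= eq_sym.
  by case: (val o == x) => /=; rewrite ?orbT.
rewrite /open_pairing dom -andbA; apply: andb_id2l => _.
rewrite -andbA; apply: andb_id2l => /forall_inP c2.
rewrite -andbA; apply: andb_id2l => _.
apply/andP/forall_inP => [[/forall_inP nT /exists_inPn nx] B BS|nT].
  (* A block inside [o :: T] but not inside [T] would pair [o] with an element of [T], which [nx]
     excludes. *)
  apply/negP => /fintype.subsetP sB.
  have oB : o \in B.
    apply: contraR (nT B BS) => noB; apply/fintype.subsetP => x xB.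
    have := sB x xB; rewrite inE => /orP[/eqP xo|//].
    by rewrite -xo xB in noB.
  have /cards2P[x [y [xy eB]]] := c2 B BS.
  move: oB; rewrite eB !inE => /orP[]/eqP eo; subst.
    have := sB y; rewrite !inE eqxx orbT eq_sym (negbTE xy) => /(_ isT) yT.
    by have := nx y yT; rewrite finset.setUC BS.
  have := sB x; rewrite !inE eqxx (negbTE xy) => /(_ isT) xT.
  by have := nx x xT; rewrite BS.
split.
  apply/forall_inP => B BS; apply: contra (nT B BS) => /fintype.subsetP sB.
  by apply/fintype.subsetP => x /sB xT; rewrite inE xT orbT.
apply/exists_inPn => x xT; apply/negP => xS.
case/negP: (nT _ xS); apply/fintype.subsetP => y; rewrite !inE.
by case/orP=> /eqP ->; rewrite ?eqxx // xT orbT.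
Qed.

(** The partner of [m] is not a waiting point, so it is [o] or lies beyond [o]. In the latter case
    its pair would cross a pair joining [o] to some [x] below [m]. *)
Lemma open_pairing_last T (o m : 'I_n) S :
  sorted gtn (map val (o :: m :: T)) -> open_pairing (m :: T) o S ->
  [exists x in m :: T, [set x; o]%SET \in S] = ([set m; o]%SET \in S).
Proof.
move=> srt /and4P[/and3P[/eqP cov triv _] /forall_inP c2 /noncrossingP nc /forall_inP nT].
apply/exists_inP/idP => [[x]|mS]; last by exists m => //; rewrite inE eqxx.
rewrite inE => /orP[/eqP -> //|xT xS].
have [ltmo ltxm] : (m < o)%N /\ (x < m)%N.
  move: srt => /= /andP[-> srt]; split=> //.
  have := order_path_min (rev_trans ltn_trans) srt.
  by move=> /allP/(_ (val x)); apply; apply: map_f.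
have mA : m \in finset.cover S by rewrite cov !inE eqxx.
set B := finset.pblock S m.
have BS : B \in S by rewrite pblock_mem.
have mB : m \in B by rewrite mem_pblock.
have [y [ym eB]] : exists y, y != m /\ B = [set m; y]%SET.
  have /cards2P[a [b [ab eB]]] := c2 _ BS.
  move: mB; rewrite eB !inE => /orP[]/eqP e; subst; first by exists b; rewrite eq_sym.
  by exists a; rewrite finset.setUC.
have yA : y \in open_dom (m :: T) o.
  by rewrite -cov; apply/bigcupP; exists B => //; rewrite eB !inE eqxx orbT.
have yT : y \notin m :: T.
  apply: contra (nT _ BS) => yT; rewrite eB; apply/fintype.subsetP => z.
  by rewrite !inE => /orP[]/eqP ->; rewrite ?eqxx // -in_cons.
move: yA; rewrite inE (negbTE yT) /= leq_eqVlt => /orP[/eqP/val_inj oy|oy].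
  by rewrite oy -eB.
by have [] := nc x m o y; rewrite ?ltxm -?eB.
Qed.

(** The left side has the shape of the condition produced by [reindex_onto] when the pair is
    removed. Putting the pair back creates no crossing, since every remaining point is below [m] or
    above [o]. *)
Lemma open_pairing_pop T (o m : 'I_n) S :
  sorted gtn (map val (o :: m :: T)) ->
  [&& open_pairing (m :: T) o ([set m; o]%SET |: S)%SET,
      [set m; o]%SET \in ([set m; o]%SET |: S)%SET &
      ([set m; o]%SET |: S)%SET :\ [set m; o]%SET == S]%SET =
  open_pairing T o.+1 S.
Proof.
move=> srt; set B0 := [set m; o]%SET.
have ltmo : (m < o)%N by case/andP: srt.
have ltT x : x \in T -> (x < m)%N.
  move: srt => /= /andP[_ srt] xT.
  have := order_path_min (rev_trans ltn_trans) srt.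
  by move=> /allP/(_ (val x)); apply; apply: map_f.
have domD : open_dom (m :: T) o :\: B0 = open_dom T o.+1.
  apply/setP => x; rewrite !inE; case: (ltngtP o x) => [ox|xo|/val_inj <-].
  - by rewrite orbT andbT negb_or -!val_eqE /= !gtn_eqF ?orbT // (ltn_trans ltmo).
  - rewrite !orbF; have [->|xm] := eqVneq x m.
      by rewrite /=; case: (boolP (m \in T)) => // /ltT; rewrite ltnn.
    by rewrite -val_eqE /= (ltn_eqF xo).
  - rewrite eqxx orbT /= orbF; symmetry; apply/negbTE/negP => /ltT.
    by rewrite ltnNge ltnW.
have domU : B0 :|: open_dom T o.+1 = open_dom (m :: T) o.
  rewrite -domD; apply/setP => x; rewrite !inE.
  have [->|] := eqVneq x m => //=.
  by have [->|] := eqVneq x o; rewrite //= leqnn orbT.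
have disj : [disjoint B0 & open_dom T o.+1].
  by rewrite -domD disjoint_sym finset.disjoints_subset; apply/fintype.subsetP => x; rewrite !inE => /andP[].
have gap x : x \in open_dom T o.+1 -> (m < x)%N -> (o < x)%N.
  by rewrite inE => /orP[/ltT xm mx|//]; have := ltn_trans xm mx; rewrite ltnn.
apply/and3P/idP => [[op _ /eqP eS]|/and4P[part /forall_inP c2 /noncrossingP nc /forall_inP nT]].
  have SU B : B \in S -> B \in (B0 |: S)%SET by rewrite !inE orbC => ->.
  case/and4P: op => part /forall_inP c2 /noncrossingP nc /forall_inP nT.
  apply/and4P; split.
  - by rewrite -domD -{1}eS partitionD1 // !inE eqxx.
  - by apply/forall_inP => B /SU; apply: c2.
  - apply/noncrossingP => i j k l ij kl /SU ? /SU ?; exact: (nc i j k l).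
  - apply/forall_inP => B /SU /nT; apply: contra => /fintype.subsetP sB.
    by apply/fintype.subsetP => x /sB xT; rewrite inE xT orbT.
have sdom B x : B \in S -> x \in B -> x \in open_dom T o.+1.
  case/and3P: part => /eqP <- _ _ BS xB; by apply/bigcupP; exists B.
have nB0 : B0 \notin S.
  apply/negP => /(sdom _ m); rewrite !inE eqxx => /(_ isT)/orP[/ltT|].
    by rewrite ltnn.
  by rewrite ltnNge ltnW.
split; last 2 first.
- by rewrite !inE eqxx.
- by rewrite setU1K.
apply/and4P; split.
- rewrite -domU partitionU1 //.
  by apply/set0Pn; exists m; rewrite !inE eqxx.
- apply/forall_inP => B; rewrite !inE => /orP[/eqP ->|/c2 //].
  by rewrite cards2 -val_eqE /= (ltn_eqF ltmo).
- apply/noncrossingP => i j k l /andP[ij jk] kl; rewrite !inE.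
  have ik := ltn_trans ij jk; have jl := ltn_trans jk kl.
  case/orP=> [/eqP/(set2_ltn_inj ik ltmo)[ei ek]|ikS].
    case/orP=> [/eqP/(set2_ltn_inj jl ltmo)[ej _]|jlS].
      by rewrite ei ej ltnn in ij.
    have := gap j; rewrite (sdom _ _ jlS) ?inE ?eqxx // -ei -ek => /(_ isT ij).
    by rewrite ltnNge ltnW.
  case/orP=> [/eqP/(set2_ltn_inj jl ltmo)[ej el]|jlS].
    have := gap k; rewrite (sdom _ _ ikS) ?inE ?eqxx ?orbT // -ej -el => /(_ isT jk).
    by rewrite ltnNge ltnW.
  by apply: (nc i j k l) => //; rewrite ij.
- apply/forall_inP => B; rewrite !inE => /orP[/eqP ->|BS].
    apply/negP => /fintype.subsetP/(_ o); rewrite !inE eqxx orbT => /(_ isT).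
    rewrite -val_eqE /= (gtn_eqF ltmo) /= => /ltT.
    by rewrite ltnNge ltnW.
  apply: contra (nT B BS) => /fintype.subsetP sB; apply/fintype.subsetP => x xB.
  have := sB x xB; rewrite inE => /orP[/eqP xm|//].
  have := sdom _ _ BS xB; rewrite inE => /orP[//|].
  by rewrite xm ltnNge ltnW.
Qed.

Lemma open_pairing_end T S :
  open_pairing T n S = (T == [::]) && (S == finset.set0).
Proof.
apply/idP/andP => [/and4P[/and3P[/eqP cov _ n0] _ _ /forall_inP nT]|].
  have S0 : S = finset.set0.
    apply/eqP; apply: contraT => /set0Pn[B BS].
    case/negP: (nT B BS); apply/fintype.subsetP => x xB.
    have : x \in open_dom T n by rewrite -cov; apply/bigcupP; exists B.
    by rewrite inE leqNgt ltn_ord orbF.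
  rewrite S0 eqxx; split=> //; case: T cov {nT} => // x T.
  by rewrite S0 /finset.cover big_set0 => /setP/(_ x); rewrite !inE eqxx.
case=> /eqP -> /eqP ->; apply/and4P; split.
- suff -> : open_dom [::] n = finset.set0 by rewrite partition_set0.
  by apply/setP => x; rewrite !inE leqNgt ltn_ord.
- by apply/forall_inP => B; rewrite inE.
- by apply/noncrossingP => i j k l _ _; rewrite inE.
- by apply/forall_inP => B; rewrite inE.
Qed.

Variable s : n.-tuple E.
Hypothesis wE : forall i j,
  w i j = (tnth s i == rv (tnth s j))%:R * kap (tnth s j).

(** A waiting point is represented on the stack by its reversed letter, the one able to close it.
    The induction is on the number of unread letters. *)
Lemma sum_open_pairing T (m : nat) :
  (m <= n)%N -> sorted gtn (map val T) -> all (fun x : 'I_n => x < m)%N T ->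
  \sum_(S | open_pairing T m S) pairing_prod S =
    word_act rv kap (drop m s) (@vac K E) [seq rv (tnth s x) | x <- T].
Proof.
move: {2}(n - m)%N (erefl (n - m)%N) => d; elim: d T m => [|d IH] T m nm lemn srt ltT.
  have -> : m = n by apply/eqP; rewrite eqn_leq lemn -subn_eq0 nm.
  under eq_bigl do rewrite open_pairing_end.
  rewrite drop_oversize ?size_tuple //= /vac.
  case: T {srt ltT} => [|x T] /=; last by rewrite big_pred0.
  rewrite big_pred1_eq /pairing_prod big1 // => i _; rewrite big_pred0 // => j.
  by rewrite inE andbF.
have ltmn : (m < n)%N by rewrite -subn_gt0 nm.
pose o : 'I_n := Ordinal ltmn.
have -> : drop m s = tnth s o :: drop m.+1 s.
  by rewrite (drop_nth (tnth s o)) ?size_tuple //; congr (_ :: _); rewrite -(tnth_nth _ s o).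
rewrite /= -/(word_act _ _ _ _) /letter_act -/(word_act _ _ _ _).
(* Whether [o] closes a waiting point or starts to wait decides between the two summands of
   [letter_act]. *)
rewrite (bigID (fun S => [exists x in T, [set x; o]%SET \in S])) /=; congr (_ + _); last first.
  under eq_bigl do rewrite (open_pairing_push T o).
  rewrite IH //=.
  - by rewrite subnS nm.
  - case: T srt ltT {IH} => //= x T -> /andP[xm _]; by rewrite andbT.
  - rewrite ltnSn; apply: sub_all ltT => x; exact: ltnW.
case: T srt ltT => [|x T] srt ltT.
  by rewrite big_pred0 // => S; apply/negbTE; rewrite negb_and; apply/orP; right; apply/exists_inP => -[].
have srt' : sorted gtn (map val (o :: x :: T)).
  by rewrite /= andbC; move: ltT srt => /= /andP[-> _] ->.
have ltxo : (x < o)%N by case/andP: srt'.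
rewrite (eq_bigl (fun S => open_pairing (x :: T) o S && ([set x; o]%SET \in S))); last first.
  move=> S; apply: andb_id2l => op; exact: open_pairing_last.
rewrite (reindex_onto (fun S => [set x; o]%SET |: S)%SET (fun S => S :\ [set x; o]%SET)%SET) /=; last first.
  by move=> S /andP[_ xS]; rewrite finset.setD1K.
under eq_bigl do rewrite -andbA open_pairing_pop //.
rewrite (eq_bigr (fun S => w x o * pairing_prod S)); last first.
  move=> S /and4P[/and3P[/eqP cov _ _] _ _ _]; apply: pairing_prodU1 => //.
  apply/negP => xS.
  have : o \in open_dom T o.+1.
    by rewrite -cov; apply/bigcupP; exists [set x; o]%SET => //; rewrite !inE eqxx orbT.
  rewrite inE ltnn orbF => oT.
  move: ltT => /= /andP[_ /allP/(_ o oT)]; by rewrite ltnn.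
rewrite -mulr_sumr IH //=.
(* [letter_act] compares the reversed waiting letter with the letter at [o], while [wE] reverses the
   latter; [rvK] reconciles them. *)
- by rewrite wE -(inj_eq (can_inj rvK)) rvK.
- by rewrite subnS nm.
- by move: srt => /= /path_sorted.
- move: ltT => /= /andP[_]; apply: sub_all => y; exact: ltnW.
Qed.

Lemma sum_noncrossing :
  \sum_(S | nc_pairing S) pairing_prod S =
    word_act rv kap s (@vac K E) [::].
Proof.
have := @sum_open_pairing [::] 0 isT isT isT; rewrite drop0 /= => <-.
apply: eq_bigl => S; rewrite /nc_pairing /open_pairing.
have -> : open_dom [::] 0 = [set: 'I_n]%SET by apply/setP => x; rewrite !inE.
rewrite -!/(noncrossing S).
(* With nothing waiting, the additional clause only asks for nonempty blocks, which their
   cardinality provides. *)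
apply/and3P/and4P => [[part c2 nc]|[]]; last by [].
split=> //; apply/forall_inP => B BS; have /forall_inP/(_ _ BS)/eqP := c2.
case/cards2P: (introT eqP (eqP (forall_inP c2 _ BS))) => x [y [xy eB]] _.
by apply/negP => /fintype.subsetP/(_ x); rewrite eB !inE eqxx => /(_ isT).
Qed.

End NoncrossingPairings.


(** * The graph algebra acting on stacks of edges *)

Section Graph.
Variables (R : realType) (Gam : wgraph R).
Implicit Types (p q : epath Gam) (e : edge Gam) (s t : seq (edge Gam)).
Implicit Types (a b : Gr Gam) (v u : vert Gam).

(** In a matched pair the earlier edge ends where the later one starts, so the ratio in
    [pairing_weight] depends on the later edge alone. *)
Let kap e : R[i] := (mu (src e) / mu (tgt e))%:C%C.
Let act := word_act (@Defs.rev R Gam) kap.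
Let vac1 : seq (edge Gam) -> R[i] := @vac _ _.

Lemma pvertS p (i : 'I_(plength p)) : pvert p i.+1 = tgt (pedge i).
Proof.
by have e0 := pedge i; rewrite /pedge (tnth_nth e0) /pvert /= (nth_map e0).
Qed.

Lemma phi_coef_act p : (phi_coef p)%:C%C = act (pedges p) vac1 [::].
Proof.
pose w (i j : 'I_(plength p)) : R[i] :=
  (pedge i == Defs.rev (pedge j))%:R * kap (pedge j).
rewrite -[RHS](@sum_noncrossing _ _ _ kap (@Defs.revK R Gam) _ w (in_tuple (pedges p))) //.
rewrite rmorph_sum; apply: eq_bigr => S _.
rewrite rmorph_prod; apply: eq_bigr => i _.
rewrite rmorph_prod; apply: eq_bigr => j _.
rewrite !pvertS rmorphM rmorph_nat /w /kap.
by case: eqP => [->|_]; rewrite ?mul0r // tgt_rev.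
Qed.

(** The stack is regarded as a path ending at [v], so the empty one also starts at [v]. *)
Definition head_vert v t : vert Gam := if t is e :: _ then src e else v.

(** A stack with nonzero coefficient is obtained from [s] by cancelling nested pairs of mutually
    reverse edges, and such cancellations preserve paths and their ends. *)
Lemma act_path v s t : is_path v s -> act s vac1 t != 0 ->
  is_path v t && (finish v t == finish v s).
Proof.
elim: s v t => [|e s IH] v t /=.
  by rewrite /vac1 /vac; case: t => [|e t] /=; rewrite !eqxx.
case/andP=> /eqP <- es; rewrite /act /= /letter_act -/(act _ _ _).
have [->|/(IH _ _ es)/=] := eqVneq (act s vac1 (Defs.rev e :: t)) 0; last first.
  by rewrite /finish /= tgt_rev => /andP[/andP[_ ->] ->].
rewrite addr0; case: t => [|e' t] //=; first by rewrite eqxx.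
have [->|_] := eqVneq e' e; last by rewrite !mul0r eqxx.
rewrite eqxx /= => h; apply: (IH _ _ es).
by apply: contraNneq h => h; rewrite -/(act _ _ _) h mulr0.
Qed.

Lemma act_head v s t : is_path v s -> act s vac1 t != 0 ->
  head_vert (finish v s) t = v.
Proof.
move=> vs /(act_path vs); case: t => [/= /eqP <- //|e t /=].
by case/andP=> /andP[/eqP].
Qed.

Definition stack_path v t p : R[i]^o :=
  (pfinish p == v)%:R * act (pedges p) vac1 t.

(* The coefficient of the stack [t] in the image of the vacuum at [v] under [a]. *)
Definition stack_coef a v t : R[i] := linext (stack_path v t) a.

Lemma stack_coef_linear v t : linear (fun a => stack_coef a v t : R[i]^o).
Proof. exact: linext_is_linear. Qed.

Lemma stack_coef0 v t : stack_coef 0 v t = 0.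
Proof. exact: (linear0 (linext (stack_path v t))). Qed.

Lemma stack_coef_path p v t :
  stack_coef (path_elt p) v t = (pfinish p == v)%:R * act (pedges p) vac1 t.
Proof. by rewrite path_elt.unlock /stack_coef linextU. Qed.

(** Linearity is a hypothesis here so that plain lambda terms can be compared without declaring a
    structure on them. *)
Lemma linear_path_ext (V : lmodType R[i]) (f g : Gr Gam -> V) :
  linear f -> linear g ->
  (forall p, f (path_elt p) = g (path_elt p)) -> f =1 g.
Proof.
move=> lf lg.
pose fL : {linear {malg R[i][epath Gam]} -> V} :=
  HB.pack f (GRing.isLinear.Build _ _ _ _ (f : {malg R[i][epath Gam]} -> V) lf).
pose gL : {linear {malg R[i][epath Gam]} -> V} :=
  HB.pack g (GRing.isLinear.Build _ _ _ _ (g : {malg R[i][epath Gam]} -> V) lg).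
by rewrite path_elt.unlock => fg; exact: (@eq_on_basis _ _ _ fL gL fg).
Qed.

(** This is multiplicativity of the representation: a concatenation is read one word after the
    other, and the indicator retains the stacks that [p] can be composed with. *)
Lemma stack_coef_mul_path p b v t :
  stack_coef (path_elt p * b) v t =
  act (pedges p) (fun t' => (pfinish p == head_vert v t')%:R * stack_coef b v t') t.
Proof.
move: b.
apply: (@linear_path_ext R[i]^o (fun b => stack_coef (path_elt p * b) v t)
  (fun b => act (pedges p)
     (fun t' => (pfinish p == head_vert v t')%:R * stack_coef b v t') t)).
- move=> c x y; rewrite mulrDr -Gr_scalerAr; exact: stack_coef_linear.
- move=> c x y; rewrite -[RHS]word_act_linear; apply: word_act_ext => t'.
  by rewrite (stack_coef_linear v t' c x y) mulrDr [c *: _]/(c * _) mulrCA.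
move=> q.
have /and3P[_ pathq _] := epathP q.
pose c : R[i] := (pfinish p == pstart q)%:R * (pfinish q == v)%:R.
(* The indicator depending on [t'] becomes the constant in [c], because a stack that [q] contributes
   to begins at [pstart q]. *)
transitivity (act (pedges p) (fun t' => c * act (pedges q) vac1 t') t); last first.
  apply: word_act_ext => t'; rewrite stack_coef_path /c -mulrA.
  have [->|h] := eqVneq (act (pedges q) vac1 t') 0; first by rewrite !mulr0.
  have [qv|] := eqVneq (pfinish q) v; last by rewrite !mul0r !mulr0.
  by congr ((_ == _)%:R * _); rewrite -qv; symmetry; exact: (act_head pathq h).
rewrite [RHS]word_actZ /c.
have [pq|pq] := eqVneq (pfinish p) (pstart q); last first.
  by rewrite mul_path0 // !mul0r stack_coef0.
rewrite mul_path stack_coef_path pcomp_finish mul1r; congr (_ * _).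
by rewrite /act /= /word_act foldr_cat.
Qed.

Lemma phi_stack a : phi a = \sum_v stack_coef a (val v) [::] *: idem v.
Proof.
move: a; apply: linear_path_ext.
- exact: linearP.
- move=> c x y; rewrite scaler_sumr -big_split; apply: eq_bigr => v _ /=.
  by rewrite (stack_coef_linear (val v) [::] c x y) scalerDl scalerA.
move=> p; rewrite phi_path_elt /phi_path phi_coef_act (bigD1 (efinish p)) //=.
rewrite stack_coef_path eqxx mul1r big1 ?addr0 // => v vp.
rewrite stack_coef_path; case: eqP => [e|_]; last by rewrite mul0r scale0r.
by case/eqP: vp; apply: val_inj.
Qed.

Lemma stack_coef_odd a v t : oddv v -> stack_coef a v t = 0.
Proof.
move=> ov; move: a; apply: (@linear_path_ext R[i]^o).
- exact: stack_coef_linear.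
- by move=> c x y; rewrite scaler0 addr0.
move=> p; rewrite stack_coef_path; case: eqP => [e|_]; last by rewrite mul0r.
by move: (pfinish_subproof p); rewrite e ov.
Qed.

Lemma phi_eq0 a : phi a = 0 <-> forall v, stack_coef a v [::] = 0.
Proof.
split=> [a0 v|a0]; last by rewrite phi_stack big1 // => v _; rewrite a0 scale0r.
have [/stack_coef_odd -> //|ev] := boolP (oddv v).
have := congr1 (fun x : Gr Gam => mcoeff (pnil (exist _ v ev)) x) a0.
rewrite phi_stack raddf_sum mcoeff0 (bigD1 (exist _ v ev)) //= big1 => [|u uv].
  by rewrite /idem path_elt.unlock mcoeffZ mcoeffUU mulr1 addr0.
rewrite /idem path_elt.unlock mcoeffZ mcoeffU.
case: eqP => [[e]|_]; last by rewrite mulr0.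
by case/eqP: uv; apply: val_inj.
Qed.

(** * Colouring each edge by its unique odd endpoint *)

Definition edge_color e : vert Gam := if oddv (src e) then src e else tgt e.

Lemma edge_color_rev e : edge_color (Defs.rev e) = edge_color e.
Proof.
rewrite /edge_color src_rev tgt_rev; have := bipartite e.
case: (oddv (src e)); case: (oddv (tgt e)) => -[h1 h2] //.
  by have := h2 isT.
by have := h1 isT.
Qed.

Definition colored (w : vert Gam) : pred (edge Gam) := [pred e | edge_color e == w].

Lemma colored_rev w e : colored w e -> colored w (Defs.rev e).
Proof. by rewrite /colored /= edge_color_rev. Qed.

Definition color_path (w : vert Gam) p : Gr Gam :=
  if all (colored w) (pedges p) then path_elt p else 0.

(** Freeness uses membership in [Grw w] through the equation [color_proj w a = a]. Substituting it
    makes the goal linear in an arbitrary [a], so that basis paths suffice. *)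
Definition color_proj (w : vert Gam) a : Gr Gam := linext (color_path w) a.

Lemma color_proj_linear w : linear (color_proj w).
Proof. exact: linext_is_linear. Qed.

HB.instance Definition _ w :=
  GRing.isLinear.Build R[i] (Gr Gam) (Gr Gam) _ (color_proj w) (color_proj_linear w).

Lemma color_proj_path w p : color_proj w (path_elt p) = color_path w p.
Proof. by rewrite /color_proj {1}path_elt.unlock linextU. Qed.

Lemma color_projM w a b :
  color_proj w a = a -> color_proj w b = b -> color_proj w (a * b) = a * b.
Proof.
move=> <- <-; have lw := color_proj_linear w.
move: a; apply: linear_path_ext => [c x y|c x y|p].
- by rewrite lw mulrDl -Gr_scalerAl lw.
- by rewrite lw mulrDl -Gr_scalerAl.
move: b; apply: linear_path_ext => [c x y|c x y|q].
- by rewrite lw mulrDr -Gr_scalerAr lw.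
- by rewrite lw mulrDr -Gr_scalerAr.
have l0 : color_proj w 0 = 0 by exact: linear0.
rewrite !color_proj_path /color_path.
case: ifP => ap; last by rewrite mul0r l0.
case: ifP => aq; last by rewrite mulr0 l0.
have [pq|pq] := eqVneq (pfinish p) (pstart q); last by rewrite mul_path0 ?l0.
by rewrite mul_path color_proj_path /color_path all_cat ap aq.
Qed.

Lemma color_proj_idem w (u : even_vert Gam) : color_proj w (idem u) = idem u.
Proof. by rewrite color_proj_path /color_path. Qed.

(** The fixed points form a subalgebra containing the generators: both edges of a length two path
    through [w] have [w] as odd endpoint. *)
Lemma color_proj_Grw (w : odd_vert Gam) a : Grw w a -> color_proj (val w) a = a.
Proof.
have lw := color_proj_linear (val w).
have lsum c : color_proj (val w) (\sum_u c u *: idem u) = \sum_u c u *: idem u.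
  by rewrite linear_sum; apply: eq_bigr => u _; rewrite linearZ /= color_proj_idem.
move=> /(_ [set x | color_proj (val w) x = x]%classic); apply; split; last first.
  move=> x [[c ->]|[p /= [p2 pw] <-]] /=; first exact: lsum.
  rewrite color_proj_path /color_path.
  have /and3P[evp pathp _] := epathP p.
  move: p2 pw evp pathp; rewrite /plength /pvert /pstart /pedges.
  case: (epath_val p) => u [|e1 [|e2 []]] //= _ e1w evu /and3P[/eqP s1 /eqP s2 _].
  rewrite /colored /= /edge_color s1 (negbTE evu) e1w eqxx /= s2 e1w.
  by rewrite (valP w) eqxx.
split; split.
- by apply/mem_set; exact: linear0.
- by move=> c x y /set_mem /= ex /set_mem /= ey; apply/mem_set; rewrite /= lw ex ey.
- apply/mem_set => /=; have := lsum (fun=> 1).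
  by under eq_bigr do rewrite scale1r.
- by move=> x y /set_mem ex /set_mem ey; apply/mem_set; exact: color_projM.
Qed.

(** * Alternating products and the colour of the top edge *)

Definition headed (w : vert Gam) t := if t is e :: _ then colored w e else false.

Lemma stack_coef_color w a v t : color_proj w a = a ->
  stack_coef a v t != 0 -> all (colored w) t.
Proof.
move=> <- h; apply: contraNT h => ct; apply/eqP; move: a.
apply: (@linear_path_ext R[i]^o).
- by move=> c x y; rewrite color_proj_linear; exact: stack_coef_linear.
- by move=> c x y; rewrite scaler0 addr0.
move=> p; rewrite color_proj_path /color_path.
case: ifP => [cp|_]; last exact: stack_coef0.
rewrite stack_coef_path.
have [->|] := eqVneq (act (pedges p) vac1 t) 0; first by rewrite mulr0.
by move/(word_act_color cp (@colored_rev w)); rewrite (negbTE ct).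
Qed.

(** Letters of [a] annihilate nothing in the image of [b], so each stack of [b] plays the vacuum for
    [a], placed at the vertex where that stack begins. *)
Lemma stack_coef_mul w a b v t : color_proj w a = a ->
  (forall t', headed w t' -> stack_coef b v t' = 0) ->
  stack_coef (a * b) v t =
  \sum_(i < (size t).+1)
     stack_coef a (head_vert v (drop i t)) (take i t) * stack_coef b v (drop i t).
Proof.
move=> <- b0; move: a; apply: (@linear_path_ext R[i]^o).
- move=> c x y; rewrite color_proj_linear mulrDl -Gr_scalerAl.
  exact: stack_coef_linear.
- move=> c x y; rewrite color_proj_linear scaler_sumr -big_split.
  apply: eq_bigr => i _; rewrite stack_coef_linear mulrDl.
  by congr (_ + _); exact: esym (mulrA _ _ _).
move=> p; rewrite color_proj_path /color_path.
case: ifP => [cp|_]; last first.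
  by rewrite mul0r stack_coef0 big1 // => i _; rewrite stack_coef0 mul0r.
rewrite stack_coef_mul_path /act (word_act_factor _ _ cp (@colored_rev w)).
  by apply: eq_bigr => i _; rewrite stack_coef_path mulrA [X in X * _]mulrC.
by move=> e t' ce; rewrite b0 ?mulr0.
Qed.

(** The term where [a] contributes the empty stack vanishes since [phi a = 0]; in the others the top
    edge comes from [a] and has colour [w]. *)
Lemma headed_mul w a b : color_proj w a = a -> phi a = 0 ->
  (forall v t, headed w t -> stack_coef b v t = 0) ->
  forall v t, stack_coef (a * b) v t != 0 -> headed w t.
Proof.
move=> ca /phi_eq0 a0 b0 v t; apply: contraNT => ht.
rewrite (stack_coef_mul _ ca (b0 v)) big1 // => -[[|i] /= ilt] _.
  by rewrite take0 a0 mul0r.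
case: t ht ilt => //= e t ce _; set u := head_vert v _.
have [->|/(stack_coef_color ca)] := eqVneq (stack_coef a u (e :: take i t)) 0.
  by rewrite mul0r.
by rewrite /= (negbTE ce).
Qed.

Lemma stack_coef1 v t : t != [::] -> stack_coef 1 v t = 0.
Proof.
move=> t0; rewrite [LHS](linear_sum (linext _)) big1 // => u _.
by rewrite [LHS]stack_coef_path /act /= /vac1 /vac (negbTE t0) mulr0.
Qed.

(** Factors are peeled off from the left: the stacks of the remaining product are headed by the
    colour [w 1], which differs from [w 0]. *)
Lemma headed_prod (k : nat) (w : nat -> odd_vert Gam) (a : nat -> Gr Gam) :
  (forall j, (j < k.+1)%N -> Grw (w j) (a j)) ->
  (forall j, (j < k.+1)%N -> phi (a j) = 0) ->
  (forall j, (j.+1 < k.+1)%N -> w j <> w j.+1) ->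
  forall v t, stack_coef (\prod_(0 <= j < k.+1) a j) v t != 0 ->
    headed (val (w 0)) t.
Proof.
elim: k w a => [|k IH] w a aw a0 ww v t; rewrite big_nat_recl //=.
  (* A single factor multiplies the empty product [1], which carries the empty stack only. *)
  rewrite big_geq //; apply: headed_mul; [exact: color_proj_Grw (aw 0%N isT)|exact: a0|].
  by move=> u [//|e s] _; exact: stack_coef1.
apply: headed_mul; [exact: color_proj_Grw (aw 0%N isT)|exact: a0|].
move=> u s hs; apply/eqP; apply: contraT => /(IH (w \o S) (a \o S)) hs'.
have {hs'} : headed (val (w 1%N)) s.
  by apply: hs' => j jk; [exact: aw|exact: a0|exact: ww].
case: s hs => //= e s; rewrite /colored /= => /eqP -> /eqP w01.
by case: (ww 0%N) => //; exact: val_inj.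
Qed.

(** * Generation by paths of length two *)

Lemma gen_subalgebra_Gr :
  gen_subalgebra (P0 Gam `|` \bigcup_(w in [set: odd_vert Gam]) Grw w)%classic
    = [set: Gr Gam]%classic.
Proof.
set G := (X in gen_subalgebra X).
have [[S0 SL] [S1 SM]] := gen_subalgebraP G.
have Ggen x : G x -> x \in gen_subalgebra G.
  by move=> Gx; apply/mem_set; move: x Gx; exact: sub_smallest.
(* By induction on the length, the first two edges split off as a generator of the [Grw] of their
   middle vertex. *)
have Gpath p : path_elt p \in gen_subalgebra G.
  have [m] := ubnP (plength p); elim: m p => // m IH p.
  case: p => -[u [|e1 [|e2 s]]] Hp; have /and3P[] := Hp => /=.
  - move=> evu _ _ _; apply: Ggen; left.
    suff -> : EPath Hp = pnil (exist _ u evu) by exact: P0_idem.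
    exact: val_inj.
  (* A single edge cannot join two even vertices. *)
  - move=> evu /andP[/eqP s1 _] evt.
    have [o1 _] := bipartite e1.
    by move: evt; rewrite /finish /= o1 // s1.
  move=> evu /and3P[/eqP s1 /eqP s2 paths] evf.
  have o1 : oddv (tgt e1) by apply/bipartite; rewrite s1.
  have ev2 : ~~ oddv (tgt e2).
    by apply/negP => /bipartite; rewrite s2 o1.
  have Hp1 : is_epath (u, [:: e1; e2]) by rewrite /is_epath /= evu s1 s2 !eqxx.
  have Hp2 : is_epath (tgt e2, s) by rewrite /is_epath /= ev2 paths.
  rewrite /plength /pedges /= !ltnS => sm.
  have pq : pfinish (EPath Hp1) = pstart (EPath Hp2) by [].
  have -> : EPath Hp = Defs.pcomp pq by exact: val_inj.
  rewrite -mul_path; apply: SM; last by apply: IH; exact: ltn_trans sm.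
  apply: Ggen; right; exists (exist _ (tgt e1) o1) => //.
  by move=> S [_]; apply; right; exists (EPath Hp1).
apply/seteqP; split=> // x _; apply: set_mem.
rewrite (malg_basisE (x : {malg R[i][epath Gam]})).
elim/big_rec: _ => // p y _ Sy; apply: SL => //.
by have := Gpath p; rewrite path_elt.unlock.
Qed.

End Graph.

Local Open Scope classical_set_scope.

Theorem proposition26 (R : realType) (Gam : wgraph R) :
  gen_subalgebra
    (P0 Gam `|` \bigcup_(w in [set: odd_vert Gam]) Grw w) = [set: Gr Gam] /\
  free_with_amalgamation (P0 Gam) (@phi R Gam) (@Grw R Gam).
Proof.
split; first exact: gen_subalgebra_Gr.
split; first exact: P0_sub_Grw.
case=> // k w a _ aw a0 ww; apply/phi_eq0 => v; apply/eqP; apply: contraT.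
(* [headed] is false at the empty stack, so its coefficient cannot be nonzero. *)
by move/(headed_prod aw a0 ww).
Qed.
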